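(* Let $M={}_{f_2}M_1\times_{f_1}M_2$ be a pseudo-Riemannian doubly warped product with metric $g=f_2^2g_1\oplus f_1^2g_2$, and let $\zeta=\zeta_1+\zeta_2$ with $\zeta_i\in\mathfrak X(M_i)$, $i=1,2$ (lifted to $M$). Then $\zeta$ is a conformal vector field on $(M,g)$ with conformal factor $\rho$ if and only if (1) $\zeta_i$ is a conformal vector field on $(M_i,g_i)$ with some conformal factor $\rho_i$, for $i=1,2$, and (2) $\rho_1+2\zeta_2(\ln f_2)=\rho_2+2\zeta_1(\ln f_1)$ on $M$. Moreover, the conformal factor of $\zeta$ is $\rho=\rho_i+2\zeta_j(\ln f_j)$, for $i\neq j$.
   Context: $(M_1,g_1)$ and $(M_2,g_2)$ are pseudo-Riemannian manifolds and $f_i:M_i\to(0,\infty)$ are smooth functions, $i=1,2$. The doubly warped product ${}_{f_2}M_1\times_{f_1}M_2$ is the product manifold $M_1\times M_2$ with metric $g=(f_2\circ\pi_2)^2\pi_1^*g_1+(f_1\circ\pi_1)^2\pi_2^*g_2$, where $\pi_i$ is the projection onto $M_i$. Functions on $M_i$ are identified with their pullbacks to $M$, and vector fields on $M_i$ with their lifts to $M$ (the lift of $\zeta_i$ is $\pi_i$-related to $\zeta_i$ and $\pi_j$-related to $0$ for $j\ne i$). A vector field $\zeta$ on a pseudo-Riemannian manifold $(N,h)$ is conformal with conformal factor $\rho$ (a smooth function on $N$) if $\mathcal L_\zeta h=\rho h$. *)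

(* Defs.v *)
From HB Require Import structures.
From mathcomp Require Import all_boot all_order all_algebra.
From mathcomp Require Import all_classical all_reals all_analysis.

Set Implicit Arguments.
Unset Strict Implicit.
Unset Printing Implicit Defensive.

Import Order.TTheory GRing.Theory Num.Theory.
Import numFieldNormedType.Exports.
Local Open Scope classical_set_scope.
Local Open Scope ring_scope.

Section Smooth.
Variable R : realType.

Definition partial n (a : 'I_n) (f : 'rV[R]_n -> R) : 'rV[R]_n -> R :=
  fun x => 'D_(delta_mx 0 a) f x.

(* C^k, for an open set U; the values of f outside U are irrelevant. *)
Fixpoint Ck n (k : nat) (U : set 'rV[R]_n) (f : 'rV[R]_n -> R) : Prop :=
  if k is k'.+1 then
    (forall x, U x -> differentiable f x) /\
    (forall a : 'I_n, Ck k' U (partial a f))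
  else forall x, U x -> {for x, continuous f}.

Definition smooth_on n (U : set 'rV[R]_n) (f : 'rV[R]_n -> R) : Prop :=
  forall k, Ck k U f.

Lemma near_differentiable (V W : normedModType R) (f g : V -> W) x :
  {near x, f =1 g} -> differentiable f x -> differentiable g x.
Proof.
move=> fg df.
have hx : \forall y \near x, (g - f) y = 0.
  near=> y; rewrite !fctE; apply/eqP; rewrite subr_eq0; apply/eqP/esym.
  by near: y.
have h0 : (g - f) \o shift x = cst ((g - f) x) + (\0 : V -> W) +o_ (0 : V) id.
  apply/eqaddoP => e e0; rewrite (nbhs_singleton hx).
  have {}hx : \forall y \near (0 : V), (g - f) (y + x) = 0.
    by have := near_shift 0 x (fun y => (g - f) y = 0); rewrite subr0 /= => <-.
  near=> y; rewrite !fctE /= addr0 subr0.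
  have -> : g (y + x) - f (y + x) = 0 by near: y; exact: hx.
  by rewrite normr0 mulr_ge0// ltW.
have dh : differentiable (g - f) x.
  apply/diff_locallyP.
  have E : 'd (g - f) x = (\0 : V -> W) :> (_ -> _).
    apply: (@diff_unique _ _ _ _ \0) => //; exact: cst_continuous.
  rewrite E; split => //; exact: cst_continuous.
rewrite (_ : g = f + (g - f)); first exact: differentiableD.
by rewrite addrC subrK.
Unshelve. all: by end_near. Qed.

Lemma near_continuous (S T : topologicalType) (f g : S -> T) x :
  {near x, f =1 g} -> {for x, continuous f} -> {for x, continuous g}.
Proof.
move=> fg; rewrite /prop_for /continuous_at (nbhs_singleton fg) => fc.
by apply: cvg_trans fc; exact: near_eq_cvg.
Qed.

Lemma smooth_onS n (U V : set 'rV[R]_n) f :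
  V `<=` U -> smooth_on U f -> smooth_on V f.
Proof.
move=> VU sf k; move: (sf k) => {sf}; elim: k f => [|k IH] f /=.
  by move=> fc x /VU; exact: fc.
by case=> fd fp; split=> [x /VU|a]; [exact: fd | exact/IH/fp].
Qed.

Lemma CkS n k (U : set 'rV[R]_n) f : Ck k.+1 U f -> Ck k U f.
Proof.
elim: k f => [|k IH] f [fd fp].
  by move=> x Ux; exact/differentiable_continuous/fd.
by split=> // a; exact/IH/fp.
Qed.

Lemma smooth_on_cst n (U : set 'rV[R]_n) (c : R) : smooth_on U (fun=> c).
Proof.
move=> k; elim: k c => [|k IH] c /=; first by move=> x _; exact: cst_continuous.
split=> [x _|a]; first exact: differentiable_cst.
by rewrite (_ : partial _ _ = fun=> 0)//; apply/funext => x; exact: derive_cst.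
Qed.

Lemma Ck_ext n k (U : set 'rV[R]_n) f g : open U ->
  (forall x, U x -> f x = g x) -> Ck k U f -> Ck k U g.
Proof.
move=> oU.
have near_fg f' g' x : (forall x, U x -> f' x = g' x) -> U x ->
    {near x, f' =1 g'}.
  move=> fg Ux; have nU : \forall y \near x, U y by exact: open_nbhs_nbhs.
  by near=> y; apply: fg; near: y.
elim: k f g => [|k IH] f g fg /=.
  by move=> fc x Ux; apply: near_continuous (fc _ Ux); exact: near_fg.
case=> fd fp; split=> [x Ux|a].
  by apply: near_differentiable (fd _ Ux); exact: near_fg.
by apply: IH (fp a) => x Ux; apply: near_eq_derive; exact: near_fg.
Unshelve. all: by end_near. Qed.

Lemma CkD n k (U : set 'rV[R]_n) f g : open U ->
  Ck k U f -> Ck k U g -> Ck k U (fun x => f x + g x).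
Proof.
move=> oU; elim: k f g => [|k IH] f g /=.
  by move=> fc gc x Ux; apply: continuousD; [exact: fc | exact: gc].
move=> [fd fp] [gd gp]; split=> [x Ux|a].
  by apply: differentiableD; [exact: fd | exact: gd].
apply: (Ck_ext oU _ (IH _ _ (fp a) (gp a))) => x Ux.
by rewrite /partial -deriveD//; apply: diff_derivable; first [exact: fd | exact: gd].
Qed.

Lemma CkM n k (U : set 'rV[R]_n) f g : open U ->
  Ck k U f -> Ck k U g -> Ck k U (fun x => f x * g x).
Proof.
move=> oU; elim: k f g => [|k IH] f g.
  by move=> fc gc x Ux; apply: continuousM; [exact: fc | exact: gc].
move=> Cf Cg; have [fd fp] := Cf; have [gd gp] := Cg; split=> [x Ux|a].
  by apply: differentiableM; [exact: fd | exact: gd].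
have := CkD oU (IH _ _ (CkS Cf) (gp a)) (IH _ _ (CkS Cg) (fp a)).
apply: Ck_ext => // x Ux.
by rewrite /partial deriveM//; apply: diff_derivable; first [exact: fd | exact: gd].
Qed.

Lemma smooth_onD n (U : set 'rV[R]_n) f g : open U ->
  smooth_on U f -> smooth_on U g -> smooth_on U (fun x => f x + g x).
Proof. by move=> oU sf sg k; exact: CkD. Qed.

Lemma smooth_onM n (U : set 'rV[R]_n) f g : open U ->
  smooth_on U f -> smooth_on U g -> smooth_on U (fun x => f x * g x).
Proof. by move=> oU sf sg k; exact: CkM. Qed.

Lemma derive_comp_linear n m (l : {linear 'rV[R]_n -> 'rV[R]_m})
    (f : 'rV[R]_m -> R) x v : 'D_v (f \o l) x = 'D_(l v) f (l x).
Proof.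
rewrite /derive; set u := (X in X @ _); set w := (X in _ = lim (X @ _)).
suff -> : u = w by [].
by apply/funext => h; rewrite /u /w /= linearP.
Qed.

Lemma lsubmx_delta n1 n2 (a : 'I_(n1 + n2)) :
  lsubmx (delta_mx 0 a : 'rV[R]_(n1 + n2)) =
  if fintype.split a is inl b then delta_mx 0 b else 0.
Proof.
case: split_ordP => b ->; apply/rowP => c; rewrite !mxE ?eqxx //=.
by rewrite eq_lrshift.
Qed.

Lemma rsubmx_delta n1 n2 (a : 'I_(n1 + n2)) :
  rsubmx (delta_mx 0 a : 'rV[R]_(n1 + n2)) =
  if fintype.split a is inr b then delta_mx 0 b else 0.
Proof.
case: split_ordP => b ->; apply/rowP => c; rewrite !mxE ?eqxx //=.
  by rewrite eq_rlshift.
by rewrite eq_rshift.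
Qed.

Lemma partial_lsubmx n1 n2 (a : 'I_(n1 + n2)) (f : 'rV[R]_n1 -> R) x :
  partial a (f \o lsubmx) x =
  if fintype.split a is inl b then partial b f (lsubmx x) else 0.
Proof.
rewrite /partial derive_comp_linear /= lsubmx_delta.
by case: fintype.split => b //; rewrite derive0.
Qed.

Lemma partial_rsubmx n1 n2 (a : 'I_(n1 + n2)) (f : 'rV[R]_n2 -> R) x :
  partial a (f \o rsubmx) x =
  if fintype.split a is inr b then partial b f (rsubmx x) else 0.
Proof.
rewrite /partial derive_comp_linear /= rsubmx_delta.
by case: fintype.split => b //; rewrite derive0.
Qed.

Lemma smooth_on_lsubmx n1 n2 (U : set 'rV[R]_n1) f : smooth_on U f ->
  smooth_on [set x : 'rV[R]_(n1 + n2) | U (lsubmx x)] (f \o lsubmx).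
Proof.
move=> sf k; move: (sf k) => {sf}; elim: k f => [|k IH] f /=.
  move=> fc x Ux; apply: continuous_comp (fc _ Ux); exact: continuous_lsubmx.
case=> fd fp; split=> [x Ux|a].
  by apply: differentiable_comp (fd _ Ux); exact: differentiable_lsubmx.
have -> := funext (partial_lsubmx a f).
by case: fintype.split => b; [exact: IH (fp b) | exact: smooth_on_cst].
Qed.

Lemma smooth_on_rsubmx n1 n2 (U : set 'rV[R]_n2) f : smooth_on U f ->
  smooth_on [set x : 'rV[R]_(n1 + n2) | U (rsubmx x)] (f \o rsubmx).
Proof.
move=> sf k; move: (sf k) => {sf}; elim: k f => [|k IH] f /=.
  move=> fc x Ux; apply: continuous_comp (fc _ Ux); exact: continuous_rsubmx.
case=> fd fp; split=> [x Ux|a].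
  by apply: differentiable_comp (fd _ Ux); exact: differentiable_rsubmx.
have -> := funext (partial_rsubmx a f).
by case: fintype.split => b; [exact: smooth_on_cst | exact: IH (fp b)].
Qed.

Lemma smooth_on_left n1 n2 (U : set 'rV[R]_n1) (V : set 'rV[R]_(n1 + n2)) f g :
  (forall x, V x -> U (lsubmx x)) -> (forall x, g x = f (lsubmx x)) ->
  smooth_on U f -> smooth_on V g.
Proof.
move=> VU /funext -> /(@smooth_on_lsubmx _ n2); exact: smooth_onS.
Qed.

Lemma smooth_on_right n1 n2 (U : set 'rV[R]_n2) (V : set 'rV[R]_(n1 + n2)) f g :
  (forall x, V x -> U (rsubmx x)) -> (forall x, g x = f (rsubmx x)) ->
  smooth_on U f -> smooth_on V g.
Proof.
move=> VU /funext -> /(@smooth_on_rsubmx n1); exact: smooth_onS.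
Qed.

Lemma continuous_row_mx (T : topologicalType) n1 n2 (u : T -> 'rV[R]_n1)
    (v : T -> 'rV[R]_n2) p :
  {for p, continuous u} -> {for p, continuous v} ->
  {for p, continuous (fun q => row_mx (u q) (v q))}.
Proof.
move=> cu cv P [Q nQ QP].
have nu : nbhs (u p) [set y : 'rV[R]_n1 | forall j, Q 0 (lshift n2 j) (y 0 j)].
  exists (fun _ j => Q 0 (lshift n2 j)); last by move=> y /(_ 0).
  by move=> k j; rewrite (ord1 k); have := nQ 0 (lshift n2 j); rewrite row_mxEl.
have nv : nbhs (v p) [set y : 'rV[R]_n2 | forall j, Q 0 (rshift n1 j) (y 0 j)].
  exists (fun _ j => Q 0 (rshift n1 j)); last by move=> y /(_ 0).
  by move=> k j; rewrite (ord1 k); have := nQ 0 (rshift n1 j); rewrite row_mxEr.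
have nuq : \forall q \near p, forall j, Q 0 (lshift n2 j) (u q 0 j) := cu _ nu.
have nvq : \forall q \near p, forall j, Q 0 (rshift n1 j) (v q 0 j) := cv _ nv.
apply: filterS2 nuq nvq => q uq vq; apply: QP => k j.
rewrite (ord1 k); case: (split_ordP j) => c ->.
  by rewrite row_mxEl; exact: uq.
by rewrite row_mxEr; exact: vq.
Qed.

End Smooth.

Lemma open_setX (S T : topologicalType) (A : set S) (B : set T) :
  open A -> open B -> open (A `*` B).
Proof.
rewrite !openE => oA oB [p q] [/= Ap Bq].
by exists (A, B); first by split=> /=; [exact: oA | exact: oB].
Qed.

Lemma hausdorff_prod (S T : topologicalType) :
  hausdorff_space S -> hausdorff_space T -> hausdorff_space (S * T)%type.
Proof.
move=> hS hT [p q] [p' q'] cpq; congr pair.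
- apply: hS => A B pA pB.
  have nA : nbhs (p, q) (A `*` [set: T]).
    by exists (A, setT) => //; split=> //; exact: filterT.
  have nB : nbhs (p', q') (B `*` [set: T]).
    by exists (B, setT) => //; split=> //; exact: filterT.
  by have [[a b] [[/= Aa _] [/= Ba _]]] := cpq _ _ nA nB; exists a.
- apply: hT => A B qA qB.
  have nA : nbhs (p, q) ([set: S] `*` A).
    by exists (setT, A) => //; split=> //; exact: filterT.
  have nB : nbhs (p', q') ([set: S] `*` B).
    by exists (setT, B) => //; split=> //; exact: filterT.
  by have [[a b] [[/= _ Ab] [/= _ Bb]]] := cpq _ _ nA nB; exists b.
Qed.

Lemma second_countable_prod (S T : topologicalType) :
  @second_countable S -> @second_countable T ->
  @second_countable (S * T)%type.
Proof.
move=> [B cB [oB bB]] [C cC [oC bC]].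
exists ((fun UV => UV.1 `*` UV.2) @` (B `*` C)); last split.
- apply: sub_countable; [exact: card_image_le | exact: countableX].
- by move=> _ [[U V] [/= BU CV] <-]; apply: open_setX; [exact: oB | exact: oC].
- move=> [p q] A [[P Q] [/= /bB [U [BU Up] UP] /bC [V [CV Vq] VQ]] PQA].
  exists (U `*` V); first by split; [exists (U, V) | split].
  by move=> [x y] [/= /UP Px /VQ Qy]; exact: PQA.
Qed.

Section Manifold.
Variable R : realType.

(* An n-dimensional smooth manifold, given by an atlas indexed by [chart]. The
   chart [i] is a homeomorphism [cmap i] from the open set [cdom i] onto an open
   subset of R^n, with inverse [cinv i]; both maps are totalized, and their
   values outside of these sets are irrelevant. *)
Record manifold (n : nat) := Manifold {
  points :> topologicalType;
  chart : Type;
  cdom : chart -> set points;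
  cmap : chart -> points -> 'rV[R]_n;
  cinv : chart -> 'rV[R]_n -> points;
  manifold_nonempty : [set: points] !=set0;
  manifold_hausdorff : hausdorff_space points;
  manifold_second_countable : @second_countable points;
  cdom_open : forall i, open (cdom i);
  cimg_open : forall i, open (cmap i @` cdom i);
  cmapK : forall i p, cdom i p -> cinv i (cmap i p) = p;
  cmap_continuous : forall i p, cdom i p -> {for p, continuous (cmap i)};
  cinv_continuous : forall i p, cdom i p ->
    {for cmap i p, continuous (cinv i)};
  cdom_cover : forall p, exists i, cdom i p;
  transition_smooth : forall i j b,
    smooth_on (cmap i @` (cdom i `&` cdom j))
      (fun x => cmap j (cinv i x) 0 b)
}.

Definition cimg n (M : manifold n) (i : chart M) : set 'rV[R]_n :=
  cmap i @` cdom i.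

Definition chart_at n (M : manifold n) (p : M) : chart M :=
  projT1 (cid (cdom_cover p)).

Definition smooth n (M : manifold n) (f : M -> R) : Prop :=
  forall i, smooth_on (cimg i) (f \o cinv i).

(* The a-th coordinate derivative of f at p in the chart i. *)
Definition pd n (M : manifold n) (i : chart M) (a : 'I_n) (f : M -> R) (p : M) :
    R :=
  partial a (f \o cinv i) (cmap i p).

(* The differential of F at p, in the charts i around p and j around F p.
   Tangent vectors are row vectors and matrices act on them on the right. *)
Definition dmap m n (M : manifold m) (N : manifold n) (F : M -> N)
    (i : chart M) (j : chart N) (p : M) : 'M[R]_(m, n) :=
  \matrix_(a, b) pd i a (fun q => cmap j (F q) 0 b) p.

Definition smooth_row n (M : manifold n) (i : chart M) (X : M -> 'rV[R]_n) :=
  forall a, smooth_on (cimg i) (fun x => X (cinv i x) 0 a).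

(* [X i p] is the row of components at p of the vector field X in the chart i,
   meaningful for p in [cdom i]. *)
Record vfield n (M : manifold n) := VField {
  vcomp :> chart M -> M -> 'rV[R]_n;
  vcomp_smooth : forall i, smooth_row i (vcomp i);
  vcomp_change : forall i j p, cdom i p -> cdom j p ->
    vcomp j p = vcomp i p *m dmap idfun i j p
}.

(* [g i p] is the Gram matrix at p of the coordinate frame of the chart i. *)
Record metric n (M : manifold n) := Metric {
  gcomp :> chart M -> M -> 'M[R]_n;
  gcomp_smooth : forall i a b,
    smooth_on (cimg i) (fun x => gcomp i (cinv i x) a b);
  gcomp_change : forall i j p, cdom i p -> cdom j p ->
    gcomp i p = dmap idfun i j p *m gcomp j p *m (dmap idfun i j p)^T;
  gcomp_sym : forall i p, cdom i p -> (gcomp i p)^T = gcomp i p;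
  gcomp_nondegenerate : forall i p, cdom i p -> gcomp i p \in unitmx
}.

Record posfun n (M : manifold n) := PosFun {
  pfun :> M -> R;
  pfun_smooth : smooth pfun;
  pfun_gt0 : forall p, 0 < pfun p
}.

Section LieDerivative.
Variables (n : nat) (M : manifold n).
Implicit Types (i : chart M) (X Y : M -> 'rV[R]_n) (f : M -> R).

(* X(f) in the chart i *)
Definition dirder i X f (p : M) : R := \sum_a X p 0 a * pd i a f p.

(* zeta(f); for smooth f, any other chart at p gives the same value. *)
Definition vact (zeta : vfield M) f (p : M) : R :=
  dirder (chart_at p) (zeta (chart_at p)) f p.

Definition bracket i X Y (p : M) : 'rV[R]_n :=
  \row_b (dirder i X (fun q => Y q 0 b) p - dirder i Y (fun q => X q 0 b) p).

Definition inner (h : metric M) i X Y (p : M) : R :=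
  (X p *m h i p *m (Y p)^T) 0 0.

(* (L_zeta h)(X, Y) = zeta(h(X, Y)) - h([zeta, X], Y) - h(X, [zeta, Y]) for
   vector fields X, Y on the domain of the chart i. *)
Definition lie_metric (zeta : vfield M) (h : metric M) i X Y (p : M) : R :=
  dirder i (zeta i) (inner h i X Y) p
  - inner h i (bracket i (zeta i) X) Y p
  - inner h i X (bracket i (zeta i) Y) p.

(* L_zeta h = rho h, tested on vector fields defined on chart domains. *)
Definition conformal (h : metric M) (zeta : vfield M) (rho : M -> R) : Prop :=
  smooth rho /\
  forall i X Y, smooth_row i X -> smooth_row i Y ->
  forall p, cdom i p -> lie_metric zeta h i X Y p = rho p * inner h i X Y p.

End LieDerivative.

Section Add.
Variables (n : nat) (M : manifold n) (X Y : vfield M).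

Definition vadd_comp (i : chart M) (p : M) : 'rV[R]_n := X i p + Y i p.

Lemma vadd_smooth i : smooth_row i (vadd_comp i).
Proof.
move=> a; rewrite (_ : (fun x => _) =
  (fun x => X i (cinv i x) 0 a + Y i (cinv i x) 0 a)).
  by apply: smooth_onD; [exact: cimg_open | exact: vcomp_smooth..].
by apply/funext => x; rewrite mxE.
Qed.

Lemma vadd_change i j p : cdom i p -> cdom j p ->
  vadd_comp j p = vadd_comp i p *m dmap (idfun : M -> M) i j p.
Proof.
by move=> ip jp; rewrite /vadd_comp mulmxDl -!(vcomp_change _ ip jp).
Qed.

Definition vadd : vfield M := VField vadd_smooth vadd_change.

End Add.

Section Zero.
Variables (n : nat) (M : manifold n).

Lemma vzero_smooth (i : chart M) : smooth_row i (fun=> 0).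
Proof.
move=> a; rewrite (_ : (fun x => _) = fun=> 0); first exact: smooth_on_cst.
by apply/funext => x; rewrite mxE.
Qed.

Lemma vzero_change (i j : chart M) (p : M) : cdom i p -> cdom j p ->
  (0 : 'rV[R]_n) = 0 *m dmap (idfun : M -> M) i j p.
Proof. by rewrite mul0mx. Qed.

Definition vzero : vfield M := VField vzero_smooth vzero_change.

End Zero.

Definition related m n (M : manifold m) (N : manifold n) (F : M -> N)
    (X : vfield M) (Y : vfield N) : Prop :=
  forall p i j, cdom i p -> cdom j (F p) -> Y j (F p) = X i p *m dmap F i j p.

Section Product.
Variables (n1 n2 : nat) (M1 : manifold n1) (M2 : manifold n2).

Let pt := (M1 * M2)%type.
Let ch := (chart M1 * chart M2)%type.

Definition prod_cdom (i : ch) : set pt := cdom i.1 `*` cdom i.2.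

Definition prod_cmap (i : ch) (p : pt) : 'rV[R]_(n1 + n2) :=
  row_mx (cmap i.1 p.1) (cmap i.2 p.2).

Definition prod_cinv (i : ch) (x : 'rV[R]_(n1 + n2)) : pt :=
  (cinv i.1 (lsubmx x), cinv i.2 (rsubmx x)).

Lemma prod_img (i : ch) (A : set M1) (B : set M2) :
  prod_cmap i @` (A `*` B) =
  [set x | (cmap i.1 @` A) (lsubmx x) /\ (cmap i.2 @` B) (rsubmx x)].
Proof.
apply/seteqP; split=> [x [[p q] [/= Ap Bq] <-]|x [[p Ap px] [q Bq qx]]] /=.
  by rewrite row_mxKl row_mxKr; split; [exists p | exists q].
by exists (p, q) => //; rewrite /prod_cmap /= px qx hsubmxK.
Qed.

Lemma prod_nonempty : [set: pt] !=set0.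
Proof.
have [p _] := manifold_nonempty M1; have [q _] := manifold_nonempty M2.
by exists (p, q).
Qed.

Lemma prod_cdom_open i : open (prod_cdom i).
Proof. by apply: open_setX; exact: cdom_open. Qed.

Lemma prod_cimg_open i : open (prod_cmap i @` prod_cdom i).
Proof.
rewrite prod_img.
have o1 : open [set x : 'rV[R]_(n1 + n2) | (cmap i.1 @` cdom i.1) (lsubmx x)].
  apply: (@open_comp _ _ lsubmx); last exact: cimg_open.
  by move=> x _; exact: continuous_lsubmx.
have o2 : open [set x : 'rV[R]_(n1 + n2) | (cmap i.2 @` cdom i.2) (rsubmx x)].
  apply: (@open_comp _ _ rsubmx); last exact: cimg_open.
  by move=> x _; exact: continuous_rsubmx.
exact: openI o1 o2.
Qed.

Lemma prod_cmapK i p : prod_cdom i p -> prod_cinv i (prod_cmap i p) = p.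
Proof.
case: p => p q [/= ip iq].
by rewrite /prod_cinv /prod_cmap /= row_mxKl row_mxKr !cmapK.
Qed.

Lemma prod_cmap_continuous i p :
  prod_cdom i p -> {for p, continuous (prod_cmap i)}.
Proof.
move=> [ip iq]; apply: continuous_row_mx.
- apply: (@continuous_comp _ _ _ fst (cmap i.1)) => //.
    exact: cvg_fst.
  exact: cmap_continuous.
- apply: (@continuous_comp _ _ _ snd (cmap i.2)) => //.
    exact: cvg_snd.
  exact: cmap_continuous.
Qed.

Lemma prod_cinv_continuous i p :
  prod_cdom i p -> {for prod_cmap i p, continuous (prod_cinv i)}.
Proof.
move=> [ip iq].
have c1 : {for prod_cmap i p, continuous (cinv i.1 \o lsubmx)}.
  apply: continuous_comp; first exact: continuous_lsubmx.
  by rewrite row_mxKl; exact: cinv_continuous.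
have c2 : {for prod_cmap i p, continuous (cinv i.2 \o rsubmx)}.
  apply: continuous_comp; first exact: continuous_rsubmx.
  by rewrite row_mxKr; exact: cinv_continuous.
move=> A [[P Q] [/= nP nQ] PQA].
have nPx : \forall x \near prod_cmap i p, P (cinv i.1 (lsubmx x)) := c1 _ nP.
have nQx : \forall x \near prod_cmap i p, Q (cinv i.2 (rsubmx x)) := c2 _ nQ.
apply: filterS2 nPx nQx => x Px Qx.
by apply: PQA.
Qed.

Lemma prod_cover p : exists i, prod_cdom i p.
Proof.
have [i ip] := cdom_cover p.1; have [j jp] := cdom_cover p.2.
by exists (i, j).
Qed.

Lemma prod_transition i j b :
  smooth_on (prod_cmap i @` (prod_cdom i `&` prod_cdom j))
    (fun x => prod_cmap j (prod_cinv i x) 0 b).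
Proof.
have -> : prod_cdom i `&` prod_cdom j =
    (cdom i.1 `&` cdom j.1) `*` (cdom i.2 `&` cdom j.2).
  by apply/seteqP; split=> p /= [[? ?] [? ?]].
rewrite prod_img; case: (split_ordP b) => c ->.
  apply: smooth_on_left (transition_smooth i.1 j.1 c) => x; first by case.
  by rewrite row_mxEl.
apply: smooth_on_right (transition_smooth i.2 j.2 c) => x; first by case.
by rewrite row_mxEr.
Qed.

Definition prod_manifold : manifold (n1 + n2) :=
  Manifold prod_nonempty
    (hausdorff_prod (@manifold_hausdorff _ M1) (@manifold_hausdorff _ M2))
    (second_countable_prod (manifold_second_countable M1)
      (manifold_second_countable M2))
    prod_cdom_open prod_cimg_open prod_cmapK prod_cmap_continuous
    prod_cinv_continuous prod_cover prod_transition.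

Local Notation M := prod_manifold.

Lemma prod_cimgP (i : chart M) x :
  cimg i x -> cimg i.1 (lsubmx x) /\ cimg i.2 (rsubmx x).
Proof.
move=> ix; have : (prod_cmap i @` (cdom i.1 `*` cdom i.2)) x := ix.
by rewrite prod_img.
Qed.

Lemma pd_fst (i : chart M) a (f : M1 -> R) (p : M) :
  pd i a (fun q : M => f q.1) p =
  if fintype.split a is inl b then pd i.1 b f p.1 else 0.
Proof. by rewrite /pd (partial_lsubmx a (f \o cinv i.1)) row_mxKl. Qed.

Lemma pd_snd (i : chart M) a (f : M2 -> R) (p : M) :
  pd i a (fun q : M => f q.2) p =
  if fintype.split a is inr b then pd i.2 b f p.2 else 0.
Proof. by rewrite /pd (partial_rsubmx a (f \o cinv i.2)) row_mxKr. Qed.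

Lemma dmap_fst (i : chart M) (j : chart M1) (p : M) :
  dmap (fun q : M => q.1) i j p = col_mx (dmap idfun i.1 j p.1) 0.
Proof.
apply/matrixP => a b; rewrite mxE (pd_fst i a (fun q => cmap j q 0 b)).
by case: split_ordP => c ->; rewrite ?col_mxEu ?col_mxEd mxE.
Qed.

Lemma dmap_snd (i : chart M) (j : chart M2) (p : M) :
  dmap (fun q : M => q.2) i j p = col_mx 0 (dmap idfun i.2 j p.2).
Proof.
apply/matrixP => a b; rewrite mxE (pd_snd i a (fun q => cmap j q 0 b)).
by case: split_ordP => c ->; rewrite ?col_mxEu ?col_mxEd mxE.
Qed.

Lemma dmap_prod (i j : chart M) (p : M) :
  dmap idfun i j p =
  block_mx (dmap idfun i.1 j.1 p.1) 0 0 (dmap idfun i.2 j.2 p.2).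
Proof.
rewrite block_mxEh -(dmap_fst i j.1) -(dmap_snd i j.2).
apply/matrixP => a b; rewrite mxE.
case: (split_ordP b) => c ->; rewrite ?row_mxEl ?row_mxEr mxE.
  by congr pd; apply/funext => q; rewrite /= row_mxEl.
by congr pd; apply/funext => q; rewrite /= row_mxEr.
Qed.

Section Lift.
Variables (X1 : vfield M1) (X2 : vfield M2).

Definition lift1_comp (i : chart M) (p : M) : 'rV[R]_(n1 + n2) :=
  row_mx (X1 i.1 p.1) 0.

Definition lift2_comp (i : chart M) (p : M) : 'rV[R]_(n1 + n2) :=
  row_mx 0 (X2 i.2 p.2).

Lemma lift1_smooth i : smooth_row i (lift1_comp i).
Proof.
move=> a; case: (split_ordP a) => b ->.
  apply: smooth_on_left (@vcomp_smooth _ _ X1 i.1 b) => x; first by move/prod_cimgP=> [].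
  by rewrite row_mxEl.
rewrite (_ : (fun x => _) = fun=> 0); first exact: smooth_on_cst.
by apply/funext => x; rewrite row_mxEr mxE.
Qed.

Lemma lift2_smooth i : smooth_row i (lift2_comp i).
Proof.
move=> a; case: (split_ordP a) => b ->.
  rewrite (_ : (fun x => _) = fun=> 0); first exact: smooth_on_cst.
  by apply/funext => x; rewrite row_mxEl mxE.
apply: smooth_on_right (@vcomp_smooth _ _ X2 i.2 b) => x; first by move/prod_cimgP=> [].
by rewrite row_mxEr.
Qed.

Lemma lift1_change i j p : cdom i p -> cdom j p ->
  lift1_comp j p = lift1_comp i p *m dmap (idfun : M -> M) i j p.
Proof.
move=> [ip _] [jp _]; rewrite dmap_prod mul_row_block.
by rewrite !(mul0mx, mulmx0) !addr0 -vcomp_change.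
Qed.

Lemma lift2_change i j p : cdom i p -> cdom j p ->
  lift2_comp j p = lift2_comp i p *m dmap (idfun : M -> M) i j p.
Proof.
move=> [_ ip] [_ jp]; rewrite dmap_prod mul_row_block.
by rewrite !(mul0mx, mulmx0) !add0r -vcomp_change.
Qed.

Definition lift1 : vfield M := VField lift1_smooth lift1_change.
Definition lift2 : vfield M := VField lift2_smooth lift2_change.

Lemma lift1_fst : related (fun q : M => q.1) lift1 X1.
Proof.
move=> p i j [ip _] jp.
by rewrite dmap_fst mul_row_col mul0mx addr0 -vcomp_change.
Qed.

Lemma lift1_snd : related (fun q : M => q.2) lift1 (vzero M2).
Proof.
by move=> p i j _ _; rewrite dmap_snd mul_row_col mul0mx mulmx0 addr0.
Qed.

Lemma lift2_fst : related (fun q : M => q.1) lift2 (vzero M1).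
Proof.
by move=> p i j _ _; rewrite dmap_fst mul_row_col mul0mx mulmx0 addr0.
Qed.

Lemma lift2_snd : related (fun q : M => q.2) lift2 X2.
Proof.
move=> p i j [_ iq] jq.
by rewrite dmap_snd mul_row_col mul0mx add0r -vcomp_change.
Qed.

End Lift.

Section DoublyWarped.
Variables (g1 : metric M1) (g2 : metric M2) (f1 : posfun M1) (f2 : posfun M2).

(* f2^2 g1 (+) f1^2 g2 *)
Definition dwarped_comp (i : chart M) (p : M) : 'M[R]_(n1 + n2) :=
  block_mx (f2 p.2 ^+ 2 *: g1 i.1 p.1) 0 0 (f1 p.1 ^+ 2 *: g2 i.2 p.2).

Lemma pfun1_smooth (i : chart M) :
  smooth_on (cimg i) (fun x => f1 (cinv i x).1 ^+ 2).
Proof.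
have s : smooth_on (cimg i) (fun x => f1 (cinv i x).1).
  apply: smooth_on_left (pfun_smooth f1 i.1) => x //.
  by move/prod_cimgP=> [].
by apply: smooth_onM => //; exact: cimg_open.
Qed.

Lemma pfun2_smooth (i : chart M) :
  smooth_on (cimg i) (fun x => f2 (cinv i x).2 ^+ 2).
Proof.
have s : smooth_on (cimg i) (fun x => f2 (cinv i x).2).
  apply: smooth_on_right (pfun_smooth f2 i.2) => x //.
  by move/prod_cimgP=> [].
by apply: smooth_onM => //; exact: cimg_open.
Qed.

Lemma dwarped_smooth (i : chart M) a b :
  smooth_on (cimg i) (fun x => dwarped_comp i (cinv i x) a b).
Proof.
have oi : open (cimg i) by exact: cimg_open.
case: (split_ordP a) => c ->; case: (split_ordP b) => d ->.
- under eq_fun do rewrite block_mxEul mxE.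
  apply: smooth_onM oi (pfun2_smooth i) _.
  apply: smooth_on_left (gcomp_smooth g1 i.1 c d) => x //.
  by move/prod_cimgP=> [].
- under eq_fun do rewrite block_mxEur mxE; exact: smooth_on_cst.
- under eq_fun do rewrite block_mxEdl mxE; exact: smooth_on_cst.
- under eq_fun do rewrite block_mxEdr mxE.
  apply: smooth_onM oi (pfun1_smooth i) _.
  apply: smooth_on_right (gcomp_smooth g2 i.2 c d) => x //.
  by move/prod_cimgP=> [].
Qed.

Lemma dwarped_change (i j : chart M) (p : M) : cdom i p -> cdom j p ->
  dwarped_comp i p =
  dmap idfun i j p *m dwarped_comp j p *m (dmap idfun i j p)^T.
Proof.
move=> [ip iq] [jp jq]; rewrite dmap_prod tr_block_mx !mulmx_block.
rewrite !(trmx0, mul0mx, mulmx0, addr0, add0r) -!scalemxAr -!scalemxAl.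
by rewrite -!gcomp_change.
Qed.

Lemma dwarped_sym (i : chart M) (p : M) : cdom i p ->
  (dwarped_comp i p)^T = dwarped_comp i p.
Proof.
move=> [ip iq]; rewrite tr_block_mx !trmx0; congr block_mx.
  by rewrite linearZ /= gcomp_sym.
by rewrite linearZ /= gcomp_sym.
Qed.

Lemma dwarped_nondegenerate (i : chart M) (p : M) : cdom i p ->
  dwarped_comp i p \in unitmx.
Proof.
move=> [ip iq]; rewrite unitmxE det_ublock unitrM -!unitmxE.
by rewrite !unitmxZ ?unitfE ?expf_neq0 ?gt_eqF ?pfun_gt0//
  !gcomp_nondegenerate.
Qed.

Definition dwarped : metric M :=
  Metric dwarped_smooth dwarped_change dwarped_sym dwarped_nondegenerate.

(* g = (f2 o pi2)^2 pi1^* g1 + (f1 o pi1)^2 pi2^* g2 *)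
Lemma dwarpedE (i : chart M) (j1 : chart M1) (j2 : chart M2) (p : M) :
  cdom i p -> cdom j1 p.1 -> cdom j2 p.2 ->
  let d1 := dmap (fun q : M => q.1) i j1 p in
  let d2 := dmap (fun q : M => q.2) i j2 p in
  dwarped i p = f2 p.2 ^+ 2 *: (d1 *m g1 j1 p.1 *m d1^T)
              + f1 p.1 ^+ 2 *: (d2 *m g2 j2 p.2 *m d2^T).
Proof.
move=> [ip iq] jp jq /=; rewrite dmap_fst dmap_snd !tr_col_mx !mul_col_mx.
rewrite !trmx0 !mul_mx_row !mul0mx !mulmx0.
rewrite -!gcomp_change//.
rewrite !scale_col_mx !scale_row_mx add_col_mx !add_row_mx !scaler0.
by rewrite !(addr0, add0r).
Qed.

End DoublyWarped.
End Product.
End Manifold.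

Arguments lift1 {R n1 n2 M1} M2 X1.
Arguments lift2 {R n1 n2} M1 {M2} X2.

(* Main.v *)
(* In a chart, (L_zeta h)(X, Y) = X A Y^T with A = zeta(h) + J h + h J^T, where J
   is the Jacobian matrix of the components of zeta; hence zeta is conformal with
   factor rho iff A = rho h in every chart. For zeta = zeta_1 + zeta_2 and the
   doubly warped metric, A is block diagonal with blocks
   f_2^2 (A_1 + 2 zeta_2(ln f_2) g_1) and f_1^2 (A_2 + 2 zeta_1(ln f_1) g_2), so
   conformality means A_i = (rho - 2 zeta_j(ln f_j)) g_i. Fixing a point of M_j
   yields rho_i, and g_i <> 0 forces rho = rho_i + 2 zeta_j(ln f_j). *)
Require Import Defs.
From mathcomp Require Import all_boot all_order all_algebra.
From mathcomp Require Import all_classical all_reals all_analysis.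
From mathcomp Require Import ring.

Set Implicit Arguments.
Unset Strict Implicit.
Unset Printing Implicit Defensive.

Import Order.TTheory GRing.Theory Num.Theory.
Import numFieldNormedType.Exports.
Local Open Scope classical_set_scope.
Local Open Scope ring_scope.

(** * Calculus of smooth functions on open subsets of R^n *)

Section SmoothFunctions.
Variable R : realType.

(** [F] is a finite sum of its coordinate functions times fixed basis vectors. *)
Lemma differentiable_rV (V : normedModType R) n (F : V -> 'rV[R]_n) x :
  (forall b, differentiable (fun y => F y 0 b) x) -> differentiable F x.
Proof.
move=> dF; rewrite (_ : F = \sum_b (fun y => F y 0 b *: delta_mx 0 b)).
  by apply: differentiable_sum => b; exact: differentiableZl.
by apply/funext => y; rewrite fct_sumE -row_sum_delta.
Qed.

Lemma derive_sum_partial n (f : 'rV[R]_n -> R) x v : differentiable f x ->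
  'D_v f x = \sum_b v 0 b * partial b f x.
Proof.
move=> df; rewrite deriveE// {1}(row_sum_delta v) linear_sum.
by apply: eq_bigr => b _; rewrite linearZ /partial deriveE.
Qed.

Lemma partial_comp m n (F : 'rV[R]_m -> 'rV[R]_n) (f : 'rV[R]_n -> R) a x :
  differentiable F x -> differentiable f (F x) ->
  partial a (f \o F) x =
  \sum_b partial a (fun y => F y 0 b) x * partial b f (F x).
Proof.
move=> dF df; rewrite /partial deriveE; last exact: differentiable_comp.
rewrite diff_comp//= -!deriveE// derive_sum_partial//.
apply: eq_bigr => b _; congr (_ * _).
by rewrite derive_mx ?mxE//; exact: diff_derivable.
Qed.

Lemma derive_ln (V : normedModType R) (f : V -> R) x v :
  differentiable f x -> 0 < f x ->
  'D_v (fun y => ln (f y)) x = 'D_v f x / f x.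
Proof.
move=> df fx0; have dl := is_derive1_ln fx0.
have dln : differentiable (@ln R) (f x) by apply/derivable1_diffP.
rewrite deriveE; last exact: (differentiable_comp df dln).
rewrite (diff_comp df dln)/= deriv1E; last exact/derivable1_diffP.
by rewrite derive1E derive_val -deriveE.
Qed.

Lemma smooth_on_partial n (U : set 'rV[R]_n) f a :
  smooth_on U f -> smooth_on U (partial a f).
Proof. by move=> sf k; have [_ /(_ a)] := sf k.+1. Qed.

Lemma Ck_sum n k (U : set 'rV[R]_n) m (F : 'I_m -> 'rV[R]_n -> R) :
  open U -> (forall a, Ck k U (F a)) -> Ck k U (fun x => \sum_a F a x).
Proof.
move=> oU; elim: m F => [|m IH] F CF.
  under eq_fun do rewrite big_ord0; exact: smooth_on_cst.
under eq_fun do rewrite big_ord_recl; apply: CkD => //; exact: IH.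
Qed.

(** Induction on the order: each partial derivative of 1/f is -(partial f) (1/f) (1/f), a product of
    functions already known to be C^k. *)
Lemma smooth_onV n (U : set 'rV[R]_n) f : open U ->
  (forall x, U x -> f x != 0) -> smooth_on U f ->
  smooth_on U (fun x => (f x)^-1).
Proof.
move=> oU f0 sf; elim=> [|k IH].
  by move=> x Ux; apply: continuousV; [exact: f0 | exact: (sf 0%N)].
have [df _] := sf 1%N; split=> [x Ux|a].
  by apply: differentiableV; [exact: df | exact: f0].
have Cp := CkM oU (CkM oU (@smooth_on_cst _ n U (-1) k)
  (smooth_on_partial a sf k)) (CkM oU IH IH).
apply: Ck_ext oU _ Cp => x Ux; rewrite /partial deriveV ?f0//; last first.
  exact/diff_derivable/df.
by rewrite -[_ *: _]/(_ * _) expr2 invfM; ring.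
Qed.

Lemma smooth_on_coord n (U : set 'rV[R]_n) (b : 'I_n) :
  smooth_on U (fun x => x 0 b).
Proof.
case=> [x _|k]; first exact: (@coord_continuous R 1 n 0 b).
split=> [x _|a].
  exact: (@differentiable_coord R 1 n x 0 b).
rewrite (_ : partial a _ = fun=> (delta_mx 0 a : 'rV_n) 0 b).
  exact: smooth_on_cst.
apply/funext => x.
have := @derive_mx R 'rV[R]_n 1 n id x _ (@derivable_id _ _ x (delta_mx 0 a)).
by rewrite derive_id => /matrixP/(_ 0 b); rewrite [RHS]mxE.
Qed.

(** By the chain rule a partial derivative of [f \o F] is a sum of products of a derivative of a
    coordinate of [F] with [partial b f \o F]. The induction on the order therefore runs over all
    smooth [f], so that it applies to [partial b f]. *)
Lemma smooth_on_comp m n (U : set 'rV[R]_m) (V : set 'rV[R]_n)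
    (F : 'rV[R]_m -> 'rV[R]_n) f : open U ->
  (forall x, U x -> V (F x)) -> (forall b, smooth_on U (fun x => F x 0 b)) ->
  smooth_on V f -> smooth_on U (f \o F).
Proof.
move=> oU UV sF.
have dF x : U x -> differentiable F x.
  by move=> Ux; apply: differentiable_rV => b; have [+ _] := sF b 1%N; exact.
move=> + k; elim: k f => [|k IH] f sf.
  move=> x Ux; apply: continuous_comp (sf 0%N _ (UV _ Ux)).
  exact/differentiable_continuous/dF.
have [df _] := sf 1%N; split=> [x Ux|a].
  by apply: differentiable_comp; [exact: dF | exact/df/UV].
have Cs : Ck k U (fun x => \sum_b partial a (fun y => F y 0 b) x *
    (partial b f \o F) x).
  apply: Ck_sum => // b; apply: CkM => //.
    exact: (smooth_on_partial a (sF b)).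
  exact/IH/smooth_on_partial.
apply: Ck_ext oU _ Cs => x Ux.
by rewrite partial_comp//; [exact: dF | exact/df/UV].
Qed.

End SmoothFunctions.

(** * Coordinate derivatives on a manifold and change of chart *)

Section ChartCalculus.
Variables (R : realType) (n : nat) (M : manifold R n).
Implicit Types (i j : chart M) (p : M) (f : M -> R) (z : M -> 'rV[R]_n).

Lemma cimg_cmap i p : cdom i p -> cimg i (cmap i p).
Proof. by move=> ip; exists p. Qed.

Lemma cinvP i x : cimg i x -> cdom i (cinv i x) /\ cmap i (cinv i x) = x.
Proof. by case=> p ip <-; rewrite cmapK. Qed.

(** A single chart is fixed because this is applied to components of fields and metrics, which have
    their meaning in that chart only. *)
Definition cdifferentiable i f p := differentiable (f \o cinv i) (cmap i p).

Lemma smooth_on_cdifferentiable i f p :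
  smooth_on (cimg i) (f \o cinv i) -> cdom i p -> cdifferentiable i f p.
Proof. by move=> sf ip; have [df _] := sf 1%N; exact/df/cimg_cmap. Qed.

Lemma cdifferentiableM i f g p :
  cdifferentiable i f p -> cdifferentiable i g p ->
  cdifferentiable i (fun q => f q * g q) p.
Proof. exact: differentiableM. Qed.

Lemma cdifferentiable_sum i m (F : 'I_m -> M -> R) p :
  (forall a, cdifferentiable i (F a) p) ->
  cdifferentiable i (fun q => \sum_a F a q) p.
Proof.
move=> dF; rewrite /cdifferentiable (_ : _ \o _ = \sum_a (F a \o cinv i)).
  exact: differentiable_sum.
by apply/funext => x; rewrite fct_sumE.
Qed.

Lemma pd_cst i a (c : R) p : pd i a (fun=> c) p = 0.
Proof. exact: derive_cst. Qed.

Lemma pdM i a f g p : cdom i p ->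
  cdifferentiable i f p -> cdifferentiable i g p ->
  pd i a (fun q => f q * g q) p = pd i a f p * g p + f p * pd i a g p.
Proof.
move=> ip df dg; rewrite /pd /partial.
have /= -> := @deriveM _ _ (f \o cinv i) (g \o cinv i) (cmap i p) (delta_mx 0 a)
  (diff_derivable df) (diff_derivable dg).
by rewrite /= cmapK// addrC; congr (_ + _); exact: mulrC.
Qed.

Lemma pd_sum i a m (F : 'I_m -> M -> R) p :
  (forall b, cdifferentiable i (F b) p) ->
  pd i a (fun q => \sum_b F b q) p = \sum_b pd i a (F b) p.
Proof.
move=> dF; rewrite /pd /partial.
rewrite (_ : _ \o _ = \sum_b (F b \o cinv i)); last first.
  by apply/funext => x; rewrite fct_sumE.
by rewrite derive_sum// => b; exact/diff_derivable/dF.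
Qed.

(** Chain rule for the transition map [T]. The factorization of [f \o cinv i] through [T] holds only
    near [cmap i p], where [cinv i] stays in the domain of [j]; this suffices for derivatives. *)
Lemma pd_change i j a f p : smooth f -> cdom i p -> cdom j p ->
  pd i a f p = \sum_b dmap idfun i j p a b * pd j b f p.
Proof.
move=> sf ip jp; pose T := cmap j \o cinv i.
have Tp : T (cmap i p) = cmap j p by rewrite /T /= cmapK.
have dT : differentiable T (cmap i p).
  apply: differentiable_rV => b; have [dT _] := transition_smooth i j b 1%N.
  by apply: dT; exists p.
have nearT : {near cmap i p, (f \o cinv j) \o T =1 f \o cinv i}.
  have : \forall x \near cmap i p, cdom j (cinv i x).
    have := cinv_continuous ip; apply; rewrite cmapK//.
    by apply: open_nbhs_nbhs; split=> //; exact: cdom_open.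
  by apply: filterS => x jx; rewrite /T /= cmapK.
rewrite [LHS]/pd [LHS]/partial -(near_eq_derive (delta_mx 0 a) nearT).
rewrite -[LHS]/(partial a _ _) partial_comp//; last first.
  by rewrite Tp; exact: smooth_on_cdifferentiable.
by apply: eq_bigr => b _; rewrite Tp mxE.
Qed.

Lemma dirder_change (zeta : vfield M) i j f p :
  smooth f -> cdom i p -> cdom j p ->
  dirder i (zeta i) f p = dirder j (zeta j) f p.
Proof.
move=> sf ip jp; rewrite /dirder (vcomp_change zeta ip jp).
under eq_bigr do rewrite (pd_change _ sf ip jp) mulr_sumr.
rewrite exchange_big; apply: eq_bigr => b _.
by rewrite mxE mulr_suml; apply: eq_bigr => a _; rewrite mulrA.
Qed.

Lemma dirderM i z f g p : cdom i p ->
  cdifferentiable i f p -> cdifferentiable i g p ->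
  dirder i z (fun q => f q * g q) p =
  dirder i z f p * g p + f p * dirder i z g p.
Proof.
move=> ip df dg; rewrite /dirder mulr_suml mulr_sumr -big_split.
by apply: eq_bigr => a _; rewrite pdM//=; ring.
Qed.

Lemma dirder_sum i z m (F : 'I_m -> M -> R) p :
  (forall b, cdifferentiable i (F b) p) ->
  dirder i z (fun q => \sum_b F b q) p = \sum_b dirder i z (F b) p.
Proof.
move=> dF; rewrite exchange_big; apply: eq_bigr => a _.
by rewrite pd_sum// mulr_sumr.
Qed.

Lemma dirder_cst i z (c : R) p : dirder i z (fun=> c) p = 0.
Proof. by apply: big1 => a _; rewrite pd_cst mulr0. Qed.

Lemma vact_ln (zeta : vfield M) (f : posfun M) i p : cdom i p ->
  vact zeta (fun q => ln (f q)) p = dirder i (zeta i) f p / f p.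
Proof.
move=> ip; have jp := projT2 (cid (cdom_cover p)).
(* The change of chart is made on the right-hand side, for [f] itself, whose smoothness is given;
   both sides are then in the chart [chart_at p]. *)
rewrite /vact (dirder_change _ (pfun_smooth f) ip jp) /dirder mulr_suml.
apply: eq_bigr => a _; rewrite -mulrA; congr (_ * _).
rewrite /pd /partial (derive_ln (f := f \o cinv _)) /= ?cmapK ?pfun_gt0//.
exact: (smooth_on_cdifferentiable (pfun_smooth f _)).
Qed.

(** The chart [chart_at p] chosen in [vact] need not vary continuously with [p]. Smoothness is
    proved for the expression zeta(f)/f in a fixed chart, which agrees with [vact] on its image. *)
Lemma vact_ln_smooth (zeta : vfield M) (f : posfun M) :
  smooth (vact zeta (fun q => ln (f q))).
Proof.
move=> i; have oi : open (cimg i) by exact: cimg_open.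
have sf := pfun_smooth f i.
have s : smooth_on (cimg i) (fun x =>
    (\sum_a zeta i (cinv i x) 0 a * partial a (f \o cinv i) x) *
    (f (cinv i x))^-1).
  apply: smooth_onM => //; last first.
    by apply: smooth_onV => // x _; rewrite gt_eqF ?pfun_gt0.
  move=> k; apply: Ck_sum => // a; apply: CkM => //.
    exact: vcomp_smooth.
  exact: smooth_on_partial.
move=> k; apply: Ck_ext oi _ (s k) => x /cinvP[ix xK].
by rewrite /= (vact_ln zeta f ix) /dirder /pd xK.
Qed.

End ChartCalculus.

(** Positive dimension is essential here: the empty matrix is both zero and invertible. *)
Lemma unitmx_neq0 (R : realType) n (A : 'M[R]_n) :
  (0 < n)%N -> A \in unitmx -> A != 0.
Proof.
case: n A => // n A _; apply: contraTneq => ->.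
by rewrite unitmxE det0 unitr0.
Qed.

(** * The Lie derivative of a metric as a matrix in a chart *)

Section LieMatrix.
Variables (R : realType) (n : nat) (M : manifold R n).
Implicit Types (i : chart M) (p : M) (z : M -> 'rV[R]_n).

Definition dermx m1 m2 i z (A : M -> 'M[R]_(m1, m2)) p : 'M[R]_(m1, m2) :=
  \matrix_(a, b) dirder i z (fun q => A q a b) p.

Definition cdifferentiable_mx m1 m2 i (A : M -> 'M[R]_(m1, m2)) p :=
  forall a b, cdifferentiable i (fun q => A q a b) p.

Lemma cdifferentiable_mulmx m1 m2 m3 i (A : M -> 'M[R]_(m1, m2))
    (B : M -> 'M[R]_(m2, m3)) p :
  cdifferentiable_mx i A p -> cdifferentiable_mx i B p ->
  cdifferentiable_mx i (fun q => A q *m B q) p.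
Proof.
move=> dA dB a b; under eq_fun do rewrite mxE.
by apply: cdifferentiable_sum => c; exact: cdifferentiableM.
Qed.

Lemma dermxM m1 m2 m3 i z (A : M -> 'M[R]_(m1, m2)) (B : M -> 'M[R]_(m2, m3))
    p : cdom i p ->
  cdifferentiable_mx i A p -> cdifferentiable_mx i B p ->
  dermx i z (fun q => A q *m B q) p =
  dermx i z A p *m B p + A p *m dermx i z B p.
Proof.
move=> ip dA dB; apply/matrixP => a b; rewrite !mxE.
under eq_fun do rewrite mxE.
rewrite dirder_sum; last by move=> c; exact: cdifferentiableM.
rewrite -big_split; apply: eq_bigr => c _.
by rewrite dirderM// !mxE.
Qed.

Lemma dermx_tr m1 m2 i z (A : M -> 'M[R]_(m1, m2)) p :
  dermx i z (fun q => (A q)^T) p = (dermx i z A p)^T.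
Proof. by apply/matrixP => a b; rewrite !mxE; under eq_fun do rewrite mxE. Qed.

Definition jac i z p : 'M[R]_n := \matrix_(a, b) pd i a (fun q => z q 0 b) p.

(** The classical coordinate formula: the (a, b) entry is zeta^c d_c h_ab + (d_a zeta^c) h_cb + h_ac
    (d_b zeta^c), summed over c. *)
Definition lie_mx (zeta : vfield M) (h : metric M) i p : 'M[R]_n :=
  dermx i (zeta i) (h i) p + jac i (zeta i) p *m h i p
  + h i p *m (jac i (zeta i) p)^T.

Lemma bracketE i z X p :
  bracket i z X p = dermx i z X p - X p *m jac i z p.
Proof.
apply/rowP => b; rewrite !mxE; congr (_ - _).
by apply: eq_bigr => a _; rewrite mxE.
Qed.

(** The Leibniz rule applied to X h Y^T yields terms in the derivatives of [X] and [Y], which cancel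
    against those in the two brackets. What remains depends only on the values of [X] and [Y] at
    [p]. *)
Lemma lie_metricE (zeta : vfield M) (h : metric M) i X Y p :
  smooth_row i X -> smooth_row i Y -> cdom i p ->
  lie_metric zeta h i X Y p = (X p *m lie_mx zeta h i p *m (Y p)^T) 0 0.
Proof.
move=> sX sY ip.
have dX : cdifferentiable_mx i X p.
  by move=> a b; rewrite ord1; exact: (smooth_on_cdifferentiable (sX b)).
have dY : cdifferentiable_mx i (fun q => (Y q)^T) p.
  move=> a b; rewrite ord1; under eq_fun do rewrite mxE.
  exact: (smooth_on_cdifferentiable (sY a)).
have dh : cdifferentiable_mx i (h i) p.
  by move=> a b; exact: (smooth_on_cdifferentiable (gcomp_smooth h i a b)).
have E : dirder i (zeta i) (inner h i X Y) p =
    (dermx i (zeta i) (fun q => X q *m h i q *m (Y q)^T) p) 0 0.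
  by rewrite mxE.
rewrite /lie_metric E dermxM//; last exact: cdifferentiable_mulmx.
rewrite dermxM// dermx_tr /inner !bracketE /lie_mx.
rewrite -[X in _ - X - _]/(_ 0 0).
set Z := dermx _ _ X _; set W := dermx _ _ Y _; set H := dermx _ _ (h i) _.
rewrite linearB /= trmx_mul !(mulmxDl, mulmxDr, mulNmx, mulmxN) !mulmxA.
by rewrite !mxE; ring.
Qed.

Lemma smooth_row_cst i (v : 'rV[R]_n) : smooth_row i (fun=> v).
Proof. by move=> a; exact: smooth_on_cst. Qed.

(** A nondegenerate Gram matrix of positive size is nonzero; this makes conformal factors unique. *)
Lemma metric_scaleI (h : metric M) i p (c d : R) : (0 < n)%N -> cdom i p ->
  c *: h i p = d *: h i p -> c = d.
Proof.
move=> n0 ip /eqP; rewrite -subr_eq0 -scalerBl scaler_eq0 subr_eq0.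
by rewrite (negPf (unitmx_neq0 n0 (gcomp_nondegenerate h ip))) orbF => /eqP.
Qed.

Lemma conformalP (h : metric M) (zeta : vfield M) (rho : M -> R) :
  conformal h zeta rho <->
  smooth rho /\
  forall i p, cdom i p -> lie_mx zeta h i p = rho p *: h i p.
Proof.
split=> [[srho conf]|[srho conf]]; split=> // i.
  move=> p ip; apply/matrixP => a b.
  (* Constant rows are admissible test fields, since these need only live on the chart; a pair of
     basis rows reads off one matrix entry. *)
  have := conf i _ _ (smooth_row_cst i (delta_mx 0 a))
    (smooth_row_cst i (delta_mx 0 b)) p ip.
  rewrite lie_metricE ?/inner//; do 2?exact: smooth_row_cst.
  by rewrite !trmx_delta -!rowE -!colE !mxE.
move=> X Y sX sY p ip; rewrite lie_metricE// conf// /inner.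
by rewrite -scalemxAr -scalemxAl mxE.
Qed.

End LieMatrix.

(** * The Lie derivative of the doubly warped metric *)

Section DoublyWarpedLie.
Variables (R : realType) (n1 n2 : nat).
Variables (M1 : manifold R n1) (M2 : manifold R n2).
Local Notation M := (prod_manifold M1 M2).

Section ProductDerivatives.
Variables (i : chart M) (p : M).
Hypothesis ip : cdom i p.
Variables (z1 : M1 -> 'rV[R]_n1) (z2 : M2 -> 'rV[R]_n2).
Variable z : M -> 'rV[R]_(n1 + n2).
Hypothesis zE : forall q, z q = row_mx (z1 q.1) (z2 q.2).

Lemma dirder_fst f : dirder i z (fun q : M => f q.1) p = dirder i.1 z1 f p.1.
Proof.
rewrite /dirder big_split_ord /= [X in _ + X]big1 ?addr0; last first.
  by move=> a _; rewrite (pd_fst i _ f) (unsplitK (inr a)) mulr0.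
by apply: eq_bigr => a _; rewrite (pd_fst i _ f) (unsplitK (inl a)) zE row_mxEl.
Qed.

Lemma dirder_snd f : dirder i z (fun q : M => f q.2) p = dirder i.2 z2 f p.2.
Proof.
rewrite /dirder big_split_ord /= [X in X + _]big1 ?add0r; last first.
  by move=> a _; rewrite (pd_snd i _ f) (unsplitK (inl a)) mulr0.
by apply: eq_bigr => a _; rewrite (pd_snd i _ f) (unsplitK (inr a)) zE row_mxEr.
Qed.

(** The [z1] block is constant along [M2] and the [z2] block along [M1], so the mixed derivatives
    vanish. *)
Lemma jac_prod : jac i z p = block_mx (jac i.1 z1 p.1) 0 0 (jac i.2 z2 p.2).
Proof.
apply/matrixP => a b; rewrite mxE.
case: (split_ordP b) => c ->.
  under [fun q : M => _]eq_fun do rewrite zE row_mxEl.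
  rewrite (pd_fst i a (fun q => z1 q 0 c)).
  by case: split_ordP => d ->; rewrite ?block_mxEul ?block_mxEdl mxE.
under [fun q : M => _]eq_fun do rewrite zE row_mxEr.
rewrite (pd_snd i a (fun q => z2 q 0 c)).
by case: split_ordP => d ->; rewrite ?block_mxEur ?block_mxEdr mxE.
Qed.

Lemma cdifferentiable_fst (f : M1 -> R) :
  smooth_on (cimg i.1) (f \o cinv i.1) ->
  cdifferentiable i (fun q : M => f q.1) p.
Proof.
move=> sf; apply: smooth_on_cdifferentiable ip.
by apply: smooth_on_left sf => x // /prod_cimgP[].
Qed.

Lemma cdifferentiable_snd (f : M2 -> R) :
  smooth_on (cimg i.2) (f \o cinv i.2) ->
  cdifferentiable i (fun q : M => f q.2) p.
Proof.
move=> sf; apply: smooth_on_cdifferentiable ip.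
by apply: smooth_on_right sf => x // /prod_cimgP[].
Qed.

End ProductDerivatives.

Variables (g1 : metric M1) (g2 : metric M2) (f1 : posfun M1) (f2 : posfun M2).
Variables (zeta1 : vfield M1) (zeta2 : vfield M2).

Let g : metric M := dwarped g1 g2 f1 f2.
Let zeta : vfield M := vadd (lift1 M2 zeta1) (lift2 M1 zeta2).
Let zlnf1 := vact zeta1 (fun p => ln (f1 p)).
Let zlnf2 := vact zeta2 (fun q => ln (f2 q)).

Lemma zetaE (i : chart M) q :
  zeta i q = row_mx (zeta1 i.1 q.1) (zeta2 i.2 q.2).
Proof.
by rewrite -[LHS]/(row_mx _ _ + row_mx _ _) add_row_mx addr0 add0r.
Qed.

(** Product rule: on f_2^2 g_1 the field acts on g_1 through zeta_1 and on f_2 through zeta_2. Since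
    zeta_2(f_2^2) = 2 f_2^2 zeta_2(ln f_2), the factor f_2^2 comes out; the other block is
    symmetric. *)
Lemma dermx_dwarped (i : chart M) (p : M) : cdom i p ->
  dermx i (zeta i) (g i) p =
  block_mx (f2 p.2 ^+ 2 *: (dermx i.1 (zeta1 i.1) (g1 i.1) p.1 +
                            (2 * zlnf2 p.2) *: g1 i.1 p.1)) 0 0
           (f1 p.1 ^+ 2 *: (dermx i.2 (zeta2 i.2) (g2 i.2) p.2 +
                            (2 * zlnf1 p.1) *: g2 i.2 p.2)).
Proof.
move=> ip; have [ip1 ip2] := ip.
have zl1 := vact_ln zeta1 f1 ip1; have zl2 := vact_ln zeta2 f2 ip2.
have nf1 : f1 p.1 != 0 by rewrite gt_eqF ?pfun_gt0.
have nf2 : f2 p.2 != 0 by rewrite gt_eqF ?pfun_gt0.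
have df1 := cdifferentiable_fst ip (pfun_smooth f1 i.1).
have df2 := cdifferentiable_snd ip (pfun_smooth f2 i.2).
have dg1 a b := cdifferentiable_fst (f := fun q => g1 i.1 q a b) ip
  (gcomp_smooth g1 i.1 a b).
have dg2 a b := cdifferentiable_snd (f := fun q => g2 i.2 q a b) ip
  (gcomp_smooth g2 i.2 a b).
apply/matrixP => a b; rewrite mxE.
case: (split_ordP a) => c ->; case: (split_ordP b) => d ->.
- under [fun q : M => _]eq_fun do rewrite block_mxEul mxE expr2.
  rewrite block_mxEul !mxE /zlnf2 zl2.
  rewrite dirderM//; last exact: cdifferentiableM.
  rewrite dirderM// (dirder_snd _ _ (zetaE i)).
  rewrite (dirder_fst _ _ (zetaE i) (fun q => g1 i.1 q c d)).
  by field.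
- under [fun q : M => _]eq_fun do rewrite block_mxEur mxE.
  by rewrite block_mxEur mxE dirder_cst.
- under [fun q : M => _]eq_fun do rewrite block_mxEdl mxE.
  by rewrite block_mxEdl mxE dirder_cst.
- under [fun q : M => _]eq_fun do rewrite block_mxEdr mxE expr2.
  rewrite block_mxEdr !mxE /zlnf1 zl1.
  rewrite dirderM//; last exact: cdifferentiableM.
  rewrite dirderM// (dirder_fst _ _ (zetaE i)).
  rewrite (dirder_snd _ _ (zetaE i) (fun q => g2 i.2 q c d)).
  by field.
Qed.

(** The Jacobian terms are block diagonal and merely scale with f_2^2 and f_1^2, so the logarithmic
    corrections all come from differentiating the metric. *)
Lemma lie_mx_dwarped (i : chart M) (p : M) : cdom i p ->
  lie_mx zeta g i p =
  block_mx (f2 p.2 ^+ 2 *: (lie_mx zeta1 g1 i.1 p.1 +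
                            (2 * zlnf2 p.2) *: g1 i.1 p.1)) 0 0
           (f1 p.1 ^+ 2 *: (lie_mx zeta2 g2 i.2 p.2 +
                            (2 * zlnf1 p.1) *: g2 i.2 p.2)).
Proof.
move=> ip; rewrite /lie_mx (dermx_dwarped ip) (jac_prod _ _ (zetaE i)).
rewrite -[g i p]/(block_mx _ 0 0 _) tr_block_mx !mulmx_block !trmx0.
rewrite !(mul0mx, mulmx0, addr0, add0r) !add_block_mx !addr0.
rewrite -!scalemxAr -!scalemxAl -!scalerDr.
by congr block_mx; congr (_ *: _);
  rewrite [RHS]addrAC; congr (_ + _); exact: addrAC.
Qed.

Lemma conformal_dwarpedP (rho : M -> R) :
  conformal g zeta rho <->
  smooth rho /\ forall (i : chart M) (p : M), cdom i p ->
    lie_mx zeta1 g1 i.1 p.1 = (rho p - 2 * zlnf2 p.2) *: g1 i.1 p.1 /\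
    lie_mx zeta2 g2 i.2 p.2 = (rho p - 2 * zlnf1 p.1) *: g2 i.2 p.2.
Proof.
apply: (iff_trans (conformalP _ _ _)).
split=> -[srho E]; split=> // i p ip; have := E i p ip; rewrite lie_mx_dwarped//;
  rewrite -[g i p]/(block_mx _ 0 0 _) scale_block_mx !scaler0.
  (* Only the diagonal blocks carry information. In each, [rho p] and the squared warping function
     are swapped so that the latter, being nonzero, can be cancelled. *)
  move=> /eq_block_mx[+ _ _ +]; rewrite !(scalerA (rho p)) ![rho p * _]mulrC.
  rewrite -!(scalerA _ (rho p)).
  move=> /scalerI E1 /scalerI E2; rewrite !scalerBl -E1 ?addrK; last first.
    by rewrite expf_neq0 ?gt_eqF ?pfun_gt0.
  by rewrite -E2 ?addrK// expf_neq0 ?gt_eqF ?pfun_gt0.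
move=> [-> ->]; rewrite -!scalerDl !subrK.
by rewrite !(scalerA (rho p)) ![rho p * _]mulrC -!(scalerA _ (rho p)).
Qed.

(** * Conformal factors on the product and on the two factors *)

Hypotheses (n1_gt0 : (0 < n1)%N) (n2_gt0 : (0 < n2)%N).

(** Each [zeta_i] has its Lie matrix written as a multiple of g_i in two ways, and g_i determines
    the coefficient. *)
Lemma dwarped_factor (rho : M -> R) (rho1 : M1 -> R) (rho2 : M2 -> R) :
  conformal g zeta rho -> conformal g1 zeta1 rho1 -> conformal g2 zeta2 rho2 ->
  forall p q, rho (p, q) = rho1 p + 2 * zlnf2 q /\
              rho (p, q) = rho2 q + 2 * zlnf1 p.
Proof.
move=> /conformal_dwarpedP[_ E] /conformalP[_ E1] /conformalP[_ E2] p q.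
have [i ip] := cdom_cover p; have [j jq] := cdom_cover q.
have [] := E (i, j) (p, q) (conj ip jq); rewrite /= E1// E2//.
by move=> /metric_scaleI -> // /metric_scaleI -> //; rewrite !subrK.
Qed.

Lemma conformal_dwarped1 (rho : M -> R) : conformal g zeta rho ->
  exists rho1, conformal g1 zeta1 rho1.
Proof.
move=> /conformal_dwarpedP[srho E]; have [q _] := manifold_nonempty M2.
have [j jq] := cdom_cover q.
(* The point [q] of [M2] is arbitrary and stays frozen; the first block equation at (p, q) then
   gives this factor. *)
exists (fun p => rho (p, q) - 2 * zlnf2 q); apply/conformalP; split.
  move=> i; have oi : open (cimg i) by exact: cimg_open.
  apply: smooth_onD => //; last exact: smooth_on_cst.
  (* The restriction of [rho] to the slice through [q] is, in charts, [rho] composed with the smooth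
     map that appends the constant coordinates of [q]. *)
  rewrite (_ : (fun x => _) = (rho \o cinv ((i, j) : chart M)) \o
      (fun x => row_mx x (cmap j q))); last first.
    by apply/funext => x; rewrite /= /prod_cinv /= row_mxKl row_mxKr cmapK.
  apply: smooth_on_comp (srho (i, j)) => //.
    move=> _ [p ip <-]; exact: (@cimg_cmap _ _ M (i, j) (p, q)).
  move=> b; case: (split_ordP b) => c ->.
    under eq_fun do rewrite row_mxEl; exact: smooth_on_coord.
  under eq_fun do rewrite row_mxEr; exact: smooth_on_cst.
by move=> i p ip; have [] := E (i, j) (p, q) (conj ip jq).
Qed.

Lemma conformal_dwarped2 (rho : M -> R) : conformal g zeta rho ->
  exists rho2, conformal g2 zeta2 rho2.
Proof.
move=> /conformal_dwarpedP[srho E]; have [p _] := manifold_nonempty M1.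
have [i ip] := cdom_cover p.
(* The same construction with a frozen point [p] of [M1]. *)
exists (fun q => rho (p, q) - 2 * zlnf1 p); apply/conformalP; split.
  move=> j; have oj : open (cimg j) by exact: cimg_open.
  apply: smooth_onD => //; last exact: smooth_on_cst.
  rewrite (_ : (fun x => _) = (rho \o cinv ((i, j) : chart M)) \o
      (fun x => row_mx (cmap i p) x)); last first.
    by apply/funext => x; rewrite /= /prod_cinv /= row_mxKl row_mxKr cmapK.
  apply: smooth_on_comp (srho (i, j)) => //.
    move=> _ [q jq <-]; exact: (@cimg_cmap _ _ M (i, j) (p, q)).
  move=> b; case: (split_ordP b) => c ->.
    under eq_fun do rewrite row_mxEl; exact: smooth_on_cst.
  under eq_fun do rewrite row_mxEr; exact: smooth_on_coord.
by move=> j q jq; have [] := E (i, j) (p, q) (conj ip jq).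
Qed.

Lemma conformal_dwarped (rho1 : M1 -> R) (rho2 : M2 -> R) :
  conformal g1 zeta1 rho1 -> conformal g2 zeta2 rho2 ->
  (forall p q, rho1 p + 2 * zlnf2 q = rho2 q + 2 * zlnf1 p) ->
  conformal g zeta (fun x : M => rho1 x.1 + 2 * zlnf2 x.2).
Proof.
move=> /conformalP[s1 E1] /conformalP[_ E2] E; apply/conformal_dwarpedP; split.
  move=> i; have oi : open (cimg i) by exact: cimg_open.
  apply: smooth_onD => //.
    by apply: smooth_on_left (s1 i.1) => x // /prod_cimgP[].
  apply: smooth_onM => //; first exact: smooth_on_cst.
  by apply: smooth_on_right (vact_ln_smooth zeta2 f2 i.2) => x // /prod_cimgP[].
(* The first block cancels directly; in the second, the compatibility condition [E] first replaces
   the factor by its expression through [rho2]. *)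
by move=> i p [ip jp]; rewrite E1// E2// {2}E !addrK.
Qed.

End DoublyWarpedLie.

Theorem theorem1 (R : realType) (n1 n2 : nat)
    (hn1 : (0 < n1)%N) (hn2 : (0 < n2)%N)
    (M1 : manifold R n1) (M2 : manifold R n2)
    (g1 : metric M1) (g2 : metric M2)
    (f1 : posfun M1) (f2 : posfun M2)
    (zeta1 : vfield M1) (zeta2 : vfield M2) :
  let M := prod_manifold M1 M2 in
  let g : metric M := dwarped g1 g2 f1 f2 in
  let zeta : vfield M := vadd (lift1 M2 zeta1) (lift2 M1 zeta2) in
  let zeta1_ln_f1 := vact zeta1 (fun p => ln (f1 p)) in
  let zeta2_ln_f2 := vact zeta2 (fun q => ln (f2 q)) in
  ((exists rho : M -> R, conformal g zeta rho) <->
   (exists (rho1 : M1 -> R) (rho2 : M2 -> R),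
      conformal g1 zeta1 rho1 /\
      conformal g2 zeta2 rho2 /\
      forall (p : M1) (q : M2),
        rho1 p + 2 * zeta2_ln_f2 q = rho2 q + 2 * zeta1_ln_f1 p)) /\
  (forall (rho : M -> R) (rho1 : M1 -> R) (rho2 : M2 -> R),
     conformal g zeta rho -> conformal g1 zeta1 rho1 ->
     conformal g2 zeta2 rho2 ->
     forall (p : M1) (q : M2),
       rho (p, q) = rho1 p + 2 * zeta2_ln_f2 q /\
       rho (p, q) = rho2 q + 2 * zeta1_ln_f1 p).
Proof.
move=> M g zeta zlnf1 zlnf2; split; last exact: dwarped_factor.
split=> [[rho conf]|[rho1 [rho2 [conf1 [conf2 E]]]]]; last first.
  by exists (fun x : M => rho1 x.1 + 2 * zlnf2 x.2); exact: conformal_dwarped E.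
have [rho1 conf1] := conformal_dwarped1 conf.
have [rho2 conf2] := conformal_dwarped2 conf.
exists rho1, rho2; do 2!split=> //; move=> p q.
(* Both sides of the compatibility condition equal [rho (p, q)]. *)
by have [<- <-] := dwarped_factor hn1 hn2 conf conf1 conf2 p q.
Qed.
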